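(* Suppose $\mathcal{A} \subseteq \mathcal{P}(\mathbb{N})$ is a $\sigma$-field. Then the following statements are logically equivalent. 1. $\mathcal{A} \subseteq \mathcal{F}$ and $\nu$ is countably additive on $\mathcal{A}$. 2. $\mathcal{A}$ is generated by a countable partition $\mathcal{S}$ of $\mathbb{N}$ (that is, $\mathcal{A} = \sigma(\mathcal{S})$) such that $\mathcal{S} \subseteq \mathcal{F}$ and $\sum_{A \in \mathcal{S}} \nu(A) = 1$.
   Context: $\mathbb{N} = \{1,2,3,\ldots\}$ and $\mathcal{P}(\mathbb{N})$ is its power set. $\mathcal{F}$ is the collection of all $A \subseteq \mathbb{N}$ for which the limit $\nu(A) := \lim_{N\to\infty} \frac{1}{N}\sum_{n=1}^N I_A(n)$ exists, where $I_A$ is the indicator function of $A$. $\sigma(\mathcal{S})$ is the $\sigma$-field of subsets of $\mathbb{N}$ generated by $\mathcal{S}$. Countable means finite or countably infinite. *)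

(* Defs.v *)
From HB Require Import structures.
From mathcomp Require Import all_boot all_order all_algebra.
From mathcomp Require Import all_classical all_reals all_analysis.
Import numFieldNormedType.Exports.
Import Order.TTheory GRing.Theory Num.Theory.

Set Implicit Arguments.
Unset Strict Implicit.
Unset Printing Implicit Defensive.

Local Open Scope classical_set_scope.
Local Open Scope ring_scope.

(* The underlying set is {1, 2, 3, ...}: subsets of it are represented as
   A : set nat with A `<=` posnat, and sigma-fields on it as
   sigma_algebra posnat, in which complements are taken relative to posnat. *)
Definition posnat : set nat := [set n | (0 < n)%N].

(* The value at N = 0 is 0 and does not affect the limit. *)
Definition frequency (R : realType) (A : set nat) (N : nat) : R :=
  N%:R^-1 * \sum_(1 <= n < N.+1) \1_A n.

Definition has_density (R : realType) : set (set nat) :=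
  [set A | A `<=` posnat /\ cvgn (frequency R A)].

(* Only meaningful on has_density R; lim is arbitrary on divergent sequences. *)
Definition density (R : realType) (A : set nat) : R := limn (frequency R A).

Definition countably_additive_on (R : realType) (C : set (set nat))
    (mu : set nat -> R) : Prop :=
  forall F : nat -> set nat, (forall i, C (F i)) -> trivIset setT F ->
  (fun n => \sum_(0 <= i < n) mu (F i)) @ \oo --> mu (\bigcup_i F i).

(* Main.v *)
Require Import Defs.
From HB Require Import structures.
From mathcomp Require Import all_boot all_order all_algebra.
From mathcomp Require Import all_classical all_reals all_analysis.
From mathcomp Require Import lra.
Import numFieldNormedType.Exports.
Import Order.TTheory GRing.Theory Num.Theory.

Set Implicit Arguments.
Unset Strict Implicit.
Unset Printing Implicit Defensive.

Local Open Scope classical_set_scope.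
Local Open Scope ring_scope.

(** If the sigma-field A lies in F and the density nu is countably additive on
    it, take for S the atoms of A.  The base set being countable, the atom of a
    point is the complement of a countable union of members of A, so it is in A
    [atom_sigma_algebra]; the atoms partition the positive integers and every
    member of A is a countable union of them [generated_by_atoms].  Countable
    additivity applied to an enumeration of the atoms makes their densities sum
    to the density of the whole set, which is 1 [esum_atom].

    Conversely, let S be a partition into sets with densities of total mass 1.
    Every member X of sigma(S) is saturated, i.e. a union of blocks
    [generated_saturated]; let [mass S X] be the sum of the densities of the
    blocks inside X.  Finitely many blocks inside X have a joint frequency that
    converges to their joint density and bounds the frequency of X from below,
    so the lower density of X is at least [mass S X] [frequency_gt_near].
    The same bound holds for the complement of X.  As the two frequencies add
    up to 1, and so do the two masses because no mass is lost, the lower bound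
    for the complement is an upper bound for X, and X has density [mass S X]
    [saturated_density].  Countable additivity of the density on sigma(S) is
    then the rearrangement of a sum of nonnegative terms [mass_bigcup]. *)

(** * Frequencies and densities *)

Section Frequency.
Variable R : realType.
Implicit Types (X B : set nat) (S T : set (set nat)) (N : nat).

Lemma frequency_ge0 X N : 0 <= frequency R X N.
Proof. by rewrite /frequency mulr_ge0 ?invr_ge0 // sumr_ge0 // => n _. Qed.

Lemma frequencyD_posnat X N : X `<=` posnat -> (0 < N)%N ->
  frequency R X N + frequency R (posnat `\` X) N = 1.
Proof.
move=> Xpos N0; rewrite /frequency -mulrDr -big_split /=.
rewrite (eq_big_nat _ _ (F2 := fun=> 1)).
  by rewrite sumr_const_nat subn1 mulVf // pnatr_eq0 -lt0n.
move=> n /andP[n0 _]; rewrite !indicE in_setD.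
have -> : n \in posnat by rewrite inE.
by case: (n \in X); rewrite ?addr0 ?add0r.
Qed.

(** A point lies in at most one set of a disjoint family. *)
Lemma sum_indic_le T X n : finite_set T -> trivIset T id ->
  (forall B, T B -> B `<=` X) ->
  \sum_(B \in T) (\1_B n : R) <= \1_X n.
Proof.
move=> finT disj TX; have [[B0 TB0 B0n]|nB] := pselect (exists2 B, T B & B n).
  rewrite (fsbigD1 B0) //= ?[X in _ + X]fsbig1 ?addr0.
  - by rewrite !indicE !mem_set //; exact: (TX _ TB0).
  - move=> B [TB BB0]; rewrite indicE memNset // => Bn; apply: BB0.
    by apply: disj => //; exists n.
rewrite fsbig1 ?indicE // => B TB.
by rewrite indicE memNset // => Bn; apply: nB; exists B.
Qed.

Lemma sum_frequency_le T X N : finite_set T -> trivIset T id ->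
  (forall B, T B -> B `<=` X) ->
  \sum_(B \in T) frequency R B N <= frequency R X N.
Proof.
move=> finT disj TX; rewrite fsbig_finite //= /frequency -mulr_sumr.
rewrite exchange_big /= ler_wpM2l ?invr_ge0 // ler_sum // => n _.
by rewrite -fsbig_finite //; exact: sum_indic_le.
Qed.

Lemma frequency_cvg X : has_density R X ->
  frequency R X @ \oo --> density R X.
Proof. by case. Qed.

Lemma density_ge0 X : has_density R X -> 0 <= density R X.
Proof.
by move=> [_ cX]; apply: limr_ge => //; apply: nearW; exact: frequency_ge0.
Qed.

Lemma density0 : density R set0 = 0.
Proof.
apply/cvg_lim => //; apply: cvg_near_cst; apply: nearW => N.
by rewrite /frequency big1 ?mulr0 // => n _; rewrite indic0.
Qed.

Lemma density_posnat : density R posnat = 1.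
Proof.
apply/cvg_lim => //; apply: cvg_near_cst; exists 1%N => // N /= N0.
rewrite -(@frequencyD_posnat posnat N) // setDv.
by rewrite [X in _ = _ + X]/frequency big1 ?mulr0 ?addr0 // => n _; rewrite indic0.
Qed.

(** * Sums of densities of blocks *)

Definition mass S X : \bar R :=
  \esum_(B in S `&` [set B | B `<=` X]) (density R B)%:E.

(** Fatou-type bound, saying that the lower density of X is at least
    [mass S X]: the sum is a supremum over finite subfamilies, and for those
    the limit of the frequencies is the sum of the densities. *)
Lemma frequency_gt_near S X r : trivIset S id -> S `<=` has_density R ->
  (r%:E < mass S X)%E -> \forall N \near \oo, r < frequency R X N.
Proof.
move=> disj dens /ereal_sup_gt[_ [T [finT TS] <-]].
rewrite fsumEFin // lte_fin => rT.
have cT : (fun N => \sum_(B \in T) frequency R B N) @ \oo -->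
    \sum_(B \in T) density R B.
  under eq_cvg do rewrite fsbig_finite // big_seq.
  rewrite fsbig_finite // big_seq.
  apply: cvg_big => [|B]; first exact: add_continuous.
  by rewrite in_fset_set // inE => /TS[SB _]; apply/frequency_cvg/dens.
near=> N; apply: (@lt_le_trans _ _ (\sum_(B \in T) frequency R B N)).
  by near: N; exact: cvgr_gt cT _ rT.
apply: sum_frequency_le => //; last by move=> B /TS[].
by apply: sub_trivIset disj => B /TS[].
Unshelve. all: by end_near. Qed.

(** For X inside the set partitioned by S, this says that X is a union of
    blocks; this form makes stability under complements and unions immediate. *)
Definition saturated S X :=
  forall B x y, S B -> B x -> B y -> X x -> X y.

Lemma massD S X : partition S id posnat -> S `<=` has_density R ->
  X `<=` posnat -> saturated S X ->
  (mass S X + mass S (posnat `\` X) = \esum_(B in S) (density R B)%:E)%E.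
Proof.
move=> [cov _ ne] dens Xpos sat.
rewrite (esumID [set B | B `<=` X]); last first.
  by move=> B SB; rewrite lee_fin; apply/density_ge0/dens.
congr (_ + esum _ _)%E; apply/seteqP; split=> B [SB] /= BX; split=> //.
  by have [x Bx] := ne _ SB; move=> /(_ _ Bx); have [_] := BX _ Bx.
move=> x Bx; split; first by rewrite -cov; exists B.
by move=> Xx; apply: BX => y By; exact: sat SB Bx By Xx.
Qed.

(** Applied to X and to its complement, the lower bound [frequency_gt_near]
    squeezes the frequency of X because both the two frequencies and the two
    masses add up to 1.  This is where total mass 1 is essential: if mass were
    lost, as with the partition into singletons, it could go to X or to its
    complement in an oscillating way. *)
Lemma saturated_density S X : partition S id posnat -> S `<=` has_density R ->
  (\esum_(B in S) (density R B)%:E = 1)%E ->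
  X `<=` posnat -> saturated S X ->
  has_density R X /\ (density R X)%:E = mass S X.
Proof.
move=> partS dens sum1 Xpos sat.
have mass_ge0 Y : (0 <= mass S Y)%E.
  by apply: esum_ge0 => B [SB _]; rewrite lee_fin; apply/density_ge0/dens.
have := massD partS dens Xpos sat; rewrite sum1.
have := mass_ge0 (posnat `\` X); have := mass_ge0 X.
case mX : (mass S X) => [p| |] //; case mC : (mass S (posnat `\` X)) => [q| |] //.
move=> _ _ [pq].
have [_ disj _] := partS.
suff freqX : frequency R X @ \oo --> p.
  split; first by split=> //; apply/cvg_ex; exists p.
  by congr (_%:E); exact: cvg_lim freqX.
apply/cvgrPdist_lt => e e0.
have nearX : \forall N \near \oo, p - e < frequency R X N.
  by apply: (frequency_gt_near disj dens); rewrite mX lte_fin gtrBl.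
have nearC : \forall N \near \oo, q - e < frequency R (posnat `\` X) N.
  by apply: (frequency_gt_near disj dens); rewrite mC lte_fin gtrBl.
near=> N.
have N0 : (0 < N)%N by near: N; exists 1%N.
have pX : p - e < frequency R X N by near: N.
have qC : q - e < frequency R (posnat `\` X) N by near: N.
have := frequencyD_posnat Xpos N0.
by rewrite ltr_norml => fD; apply/andP; split; lra.
Unshelve. all: by end_near. Qed.

End Frequency.

(** * The sigma-field generated by a partition *)

Lemma saturated_sigma_algebra (D : set nat) S : partition S id D ->
  sigma_algebra D [set X | X `<=` D /\ saturated S X].
Proof.
move=> [cov disj ne]; split=> /=.
- by split => // B x y.
- move=> X [XD sat]; split=> [x []//|B x y SB Bx By [_ nXx]].
  split; first by rewrite -cov; exists B.
  by move=> Xy; apply: nXx; exact: sat SB By Bx Xy.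
- move=> F FS; split=> [x [i _ /(FS i).1]//|B x y SB Bx By [i _ Fix]].
  by exists i => //; exact: (FS i).2 SB Bx By Fix.
Qed.

Lemma generated_saturated (D : set nat) S X : partition S id D ->
  <<s D, S >> X -> X `<=` D /\ saturated S X.
Proof.
move=> partS; have [cov disj _] := partS.
apply: (smallest_sub (saturated_sigma_algebra partS)) => B SB; split.
  by move=> x Bx; rewrite -cov; exists B.
move=> B' x y SB' B'x B'y Bx.
by rewrite (disj B B') //; exists x.
Qed.

(** The blocks are nonempty and the sets F i disjoint, so a block inside the
    union lies in exactly one F i; grouping the blocks accordingly rearranges a
    sum of nonnegative terms. *)
Lemma mass_bigcup (R : realType) (S : set (set nat)) (F : nat -> set nat) :
  partition S id posnat -> S `<=` has_density R ->
  trivIset setT F -> (forall i, saturated S (F i)) ->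
  mass R S (\bigcup_i F i) = (\sum_(0 <= i <oo) mass R S (F i))%E.
Proof.
move=> [_ _ ne] dens disjF satF.
have mass_ge0 Y : (0 <= mass R S Y)%E.
  by apply: esum_ge0 => B [SB _]; rewrite lee_fin; apply/density_ge0/dens.
rewrite nneseries_esumT // /mass -esum_bigcup.
- congr esum; apply/seteqP; split=> [B [SB /= BF]|B [i _ [SB /= BF]]].
    have [x Bx] := ne _ SB; have [i _ Fix] := BF _ Bx.
    by exists i => //; split=> // y By; exact: satF SB Bx By Fix.
  by split=> // x /BF Fix; exists i.
- move=> i j _ _ [B [[SB /= Bi] [_ /= Bj]]].
  by have [x Bx] := ne _ SB; apply: disjF => //; exists x; split; auto.
- by move=> B [i _ [SB _]]; rewrite lee_fin; apply/density_ge0/dens.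
Qed.

(** * Atoms of a sigma-field on a set of integers *)

Section Atoms.
Variables (D : set nat) (A : set (set nat)).
Hypotheses (subA : forall X, A X -> X `<=` D) (sigmaA : sigma_algebra D A).

Definition atom (x : nat) : set nat :=
  [set y | D y /\ forall X, A X -> X x -> X y].

Lemma atom_refl x : D x -> atom x x. Proof. by []. Qed.

(** The relation of lying in the same members of A is symmetric because A is
    stable under complements. *)
Lemma atom_eq x y : D x -> atom x y -> atom y = atom x.
Proof.
have [_ AC _] := sigmaA.
move=> Dx [Dy xy]; apply/seteqP; split=> z [Dz zP]; split=> // X AX.
  by move=> Xx; apply: (zP _ AX); exact: xy.
move=> Xy; apply: (zP _ AX); apply: contrapT => nXx.
by have [] := xy _ (AC _ AX) (conj Dx nXx).
Qed.

(** The definition of an atom intersects a possibly uncountable family.  To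
    cut the atom of x out of D it is enough to choose, for each of the countably
    many points y outside it, one member of A that contains x but not y. *)
Lemma atom_sigma_algebra x : D x -> A (atom x).
Proof.
have [A0 AC AU] := sigmaA => Dx.
have AD : A D by rewrite -[D]setD0; exact: AC.
have /choice[Y YP] : forall y, exists Y, [/\ A Y, Y x &
    D y -> ~ atom x y -> ~ Y y].
  move=> y; have [[Y [AY Yx nYy]]|nY] :=
      pselect (exists Y, [/\ A Y, Y x & ~ Y y]); first by exists Y.
  (* Nothing separates y from x: the whole set serves as a dummy choice. *)
  exists D; split=> // Dy; case; split=> // X AX Xx.
  by apply: contrapT => nXy; apply: nY; exists X.
rewrite (_ : atom x = D `\` \bigcup_y (D `\` Y y)).
  by apply/AC/AU => y; apply: AC; case: (YP y).
apply/seteqP; split=> [z [Dz xz]|z [Dz nz]].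
  split=> // -[y _ [_]]; apply; have [AY Yx _] := YP y; exact: xz.
apply: contrapT => nxz; apply: nz; exists z => //; split => //.
by have [_ _] := YP z; exact.
Qed.

Lemma partition_atom : partition (atom @` D) id D.
Proof.
split.
- apply/seteqP; split=> [y [_ [x _ <-]] []//|x Dx].
  by exists (atom x); [exists x|exact: atom_refl].
- move=> _ _ [x Dx <-] [y Dy <-] [z [xz yz]].
  by rewrite -(atom_eq Dx xz) (atom_eq Dy yz).
- by move=> _ [x Dx <-]; exists x; exact: atom_refl.
Qed.

(** Every member of A is a union of atoms, indexed by its own points and
    therefore countable. *)
Lemma generated_by_atoms : A = <<s D, atom @` D >>.
Proof.
apply/seteqP; split=> [X AX|]; last first.
  by apply: smallest_sub => // _ [x Dx <-]; exact: atom_sigma_algebra.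
rewrite (_ : X = \bigcup_n (if n \in X then atom n else set0)).
  apply: sigma_algebra_bigcup => n; case: ifPn => [/set_mem Xn|_].
    by apply: sub_sigma_algebra; exists n => //; exact: subA Xn.
  exact: sigma_algebra0.
apply/seteqP; split=> [n Xn|m [n _]].
  by exists n => //; rewrite mem_set //; apply/atom_refl/(subA AX).
by case: ifPn => // /set_mem Xn [_]; exact.
Qed.

(** Countable additivity concerns sequences of disjoint sets, whereas the map
    sending a point to its atom repeats each atom.  Keeping one representative
    per atom and the empty set at all other indices gives such a sequence. *)
Lemma esum_atom (R : realType) (mu : set nat -> R) : mu set0 = 0 ->
  (forall X, A X -> 0 <= mu X) -> countably_additive_on A mu ->
  (\esum_(X in atom @` D) (mu X)%:E = (mu D)%:E)%E.
Proof.
move=> mu0 mu_ge0 addmu; have [A0 _ _] := sigmaA.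
(* The chosen point of an atom depends only on the atom as a set, so it is
   the same for all points of that atom. *)
pose J := [set n | D n /\ xget 0%N (atom n) = n].
have injJ : set_inj J atom.
  by move=> n m /set_mem[_ {2}<-] /set_mem[_ {2}<-] ->.
have atomJ n : D n -> exists2 m, J m & atom m = atom n.
  move=> Dn; have nm : atom n (xget 0%N (atom n)).
    by apply: (@xgetPex _ 0%N); exists n; exact: atom_refl.
  exists (xget 0%N (atom n)); last exact: atom_eq nm.
  by split; [case: nm|rewrite (atom_eq Dn nm)].
have -> : atom @` D = atom @` J.
  apply/seteqP; split=> _ [n Dn <-]; last by exists n => //; case: Dn.
  by have [m Jm <-] := atomJ _ Dn; exists m.
rewrite esum_image // esum_mkcond.
pose F n := if n \in J then atom n else set0.
have AF n : A (F n).
  by rewrite /F; case: ifPn => // /set_mem[Dn _]; exact: atom_sigma_algebra.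
have disjF : trivIset setT F.
  move=> n m _ _ [x []]; rewrite /F.
  case: ifPn => // Jn; case: ifPn => // Jm nx mx; apply: injJ => //.
  by rewrite -(atom_eq (set_mem Jn).1 nx) (atom_eq (set_mem Jm).1 mx).
have bigF : \bigcup_n F n = D.
  apply/seteqP; split=> [x [n _]|n Dn]; rewrite /F.
    by case: ifPn => // _ [].
  have [m Jm mn] := atomJ _ Dn; exists m => //.
  by rewrite mem_set // mn; exact: atom_refl.
rewrite (eq_esum (b := fun n => (mu (F n))%:E)); last first.
  by move=> n _; rewrite /F; case: ifP => // _; rewrite mu0.
rewrite -nneseries_esumT; last by move=> n; rewrite lee_fin mu_ge0.
apply/cvg_lim => //; under eq_cvg do rewrite sumEFin.
by rewrite -bigF; apply: cvg_EFin; [exact: nearW|exact: addmu].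
Qed.

End Atoms.

Theorem theorem8p1 (R : realType) (A : set (set nat))
    (subA : forall X : set nat, A X -> X `<=` posnat)
    (sigmaA : sigma_algebra posnat A) :
  (A `<=` has_density R /\ countably_additive_on A (@density R))
  <->
  (exists S : set (set nat),
    [/\ countable S,
        partition S id posnat,
        A = <<s posnat, S >>,
        S `<=` has_density R &
        (\esum_(X in S) (density R X)%:E = 1)%E]).
Proof.
split=> [[Adens addA]|[S [_ partS AS dens sum1]]].
  exists (atom posnat A @` posnat); split.
  - apply: (sub_countable (card_image_le _ _)); exact: countableP.
  - exact: partition_atom.
  - exact: generated_by_atoms.
  - by move=> _ [x x0 <-]; apply: Adens; exact: atom_sigma_algebra.
  - rewrite (esum_atom sigmaA) // ?density_posnat ?density0 // => X AX.
    exact/density_ge0/Adens.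
have densA X : A X -> has_density R X /\ (density R X)%:E = mass R S X.
  by rewrite AS => /(generated_saturated partS)[Xpos]; exact: saturated_density.
split=> [X /densA[]//|F AF disjF].
have [_ _ AU] := sigmaA.
have massF : (\sum_(0 <= i < n) mass R S (F i))%E @[n --> \oo] -->
    (density R (\bigcup_i F i))%:E.
  rewrite (densA _ (AU _ AF)).2 mass_bigcup //; last first.
    by move=> i; have := AF i; rewrite AS => /(generated_saturated partS)[].
  apply: is_cvg_nneseries => i _ _; rewrite -(densA _ (AF i)).2 lee_fin.
  exact/density_ge0/(densA _ (AF i)).1.
have /fine_cvgP[_] : (\sum_(0 <= i < n) density R (F i))%:E @[n --> \oo] -->
    (density R (\bigcup_i F i))%:E.
  under eq_cvg => n.
    rewrite -sumEFin; under eq_bigr => i _ do rewrite (densA _ (AF i)).2.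
    over.
  exact: massF.
exact.
Qed.
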